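(* Let $W$ be a finite Coxeter group, $\mathbb{K}$ a field of characteristic $0$ and $M=M(W)$ the biHecke monoid. For every $w\in W$, the translation module $T_w$ is an indecomposable $\mathbb{K}M$-module, and it is a quotient of the indecomposable projective module $P_w$ of $\mathbb{K}M$.
   Context: $W=\langle s_i\mid i\in I\rangle$ is a finite Coxeter group with identity $1$, length $\ell$, longest element $w_0$; $D_R(w)=\{i\in I:\ell(ws_i)<\ell(w)\}$. Right weak order: $u\le_Rw$ iff $\ell(w)=\ell(u)+\ell(u^{-1}w)$; $[1,w]_R$ is the interval. $M(W)$ is the monoid of functions $W\to W$ (acting on the right) generated by all $\pi_i,\overline\pi_i$, $i\in I$, where $w.\pi_i=w$ if $i\in D_R(w)$ and $ws_i$ otherwise, and $w.\overline\pi_i=ws_i$ if $i\in D_R(w)$ and $w$ otherwise. All modules are right modules. $T_w$ is the right $\mathbb{K}M$-module with basis $[1,w]_R$ in which, for $u\in[1,w]_R$: $u.\pi_i=u$ if $i\in D_R(u)$; $us_i$ if $i\notin D_R(u)$ and $us_i\in[1,w]_R$; $0$ otherwise; and $u.\overline\pi_i=us_i$ if $i\in D_R(u)$; $u$ if $i\notin D_R(u)$ and $us_i\in[1,w]_R$; $0$ otherwise. (It is the right class module of the idempotent of $M$ with image set $[w,w_0]_L$, the interval in left weak order.) $S_w$ is the simple $\mathbb{K}M$-module attached by the Clifford–Munn–Ponizovskiĭ construction to the $\mathcal J$-class of that idempotent, i.e. $S_w$ is the simple module $T_w/\operatorname{rad}T_w$, and $P_w$ is the indecomposable projective $\mathbb{K}M$-module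 with top $S_w$. *)

(* Defs.v *)
From HB Require Import structures.
From mathcomp Require Import all_boot all_order all_algebra all_fingroup.
From mathcomp Require Import finmap monalg zify.

Set Implicit Arguments.
Unset Strict Implicit.
Unset Printing Implicit Defensive.

Import GroupScope.

(* A finite group W with a Coxeter presentation
     < s_i | (s_i s_j) ^ m_ij = 1 >,  m_ii = 1, m_ij = m_ji <> 1 for i <> j.
   The value m_ij = 0 encodes m_ij = oo: the corresponding relation is then
   trivial. That the relations present W is expressed by [cox_univ], the
   universal property (existence part; uniqueness follows from [cox_span]). *)
Record finCoxeterSystem := FinCoxeterSystem {
  cox_group :> finGroupType;
  cox_index : finType;
  cox_gen : cox_index -> cox_group;
  cox_mat : cox_index -> cox_index -> nat;
  cox_mat_diag : forall i, cox_mat i i = 1%N;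
  cox_mat_sym : forall i j, cox_mat i j = cox_mat j i;
  cox_mat_offdiag : forall i j, i != j -> cox_mat i j != 1%N;
  cox_rel : forall i j, (cox_gen i * cox_gen j) ^+ cox_mat i j = 1;
  cox_span : <<[set cox_gen i | i : cox_index]>> = [set: cox_group];
  cox_univ : forall (G : groupType) (f : cox_index -> G),
    (forall i j, (f i * f j) ^+ cox_mat i j = 1) ->
    exists2 phi : cox_group -> G,
      {morph phi : x y / x * y} & forall i, phi (cox_gen i) = f i
}.

Section Coxeter.
Variable W : finCoxeterSystem.
Local Notation I := (cox_index W).
Local Notation s := (@cox_gen W).
Implicit Types (u v w x y : W) (i j : I) (r : seq I).

Definition wprod r : W := \prod_(i <- r) s i.

Lemma word_ex w : exists n, [exists r : n.-tuple I, wprod r == w].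
Proof.
have: w \in <<[set s i | i : I]>> by rewrite cox_span inE.
case/gen_prodgP=> n [c /[swap] -> cP].
have cP' k : exists i, s i == c k.
  by have /imsetP[i _ ->] := cP k; exists i.
exists n; apply/existsP; exists [tuple xchoose (cP' k) | k < n].
apply/eqP; rewrite /wprod big_map /= (_ : enum 'I_n = index_enum _);
  last by rewrite enumT [index_enum _]unlock.
by apply: eq_bigr => k _; apply/eqP/(xchooseP (cP' k)).
Qed.

Definition len w : nat := ex_minn (word_ex w).

Definition descR w : {set I} := [set i | len (w * s i) < len w].

Definition leR u w : bool := len w == (len u + len (u^-1 * w))%N.

Lemma wprod_cons i r : wprod (i :: r) = s i * wprod r.
Proof. by rewrite /wprod big_cons. Qed.

Lemma wprod_cat r1 r2 : wprod (r1 ++ r2) = wprod r1 * wprod r2.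
Proof. by rewrite /wprod big_cat. Qed.

Lemma gen2 i : s i * s i = 1.
Proof. by have := cox_rel i i; rewrite cox_mat_diag expg1. Qed.

Lemma genV i : (s i)^-1 = s i.
Proof. by apply/eqP; rewrite eq_invg_mul gen2. Qed.

Lemma mulgenK i w : w * s i * s i = w.
Proof. by rewrite -mulgA gen2 mulg1. Qed.

Lemma mulKgen i w : s i * (s i * w) = w.
Proof. by rewrite mulgA gen2 mul1g. Qed.

Lemma wprod_rev r : wprod (rev r) = (wprod r)^-1.
Proof.
elim: r => [|i r IHr]; first by rewrite /wprod !big_nil invg1.
by rewrite rev_cons -cats1 wprod_cat IHr !wprod_cons invMg genV
   /wprod big_nil mulg1.
Qed.

Lemma redw w : exists2 r, wprod r = w & size r = len w.
Proof.
rewrite /len; case: ex_minnP => n /existsP[r /eqP rP] _.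
by exists r; rewrite ?size_tuple.
Qed.

Lemma len_wprod r : len (wprod r) <= size r.
Proof.
rewrite /len; case: ex_minnP => n _; apply; apply/existsP.
by exists (in_tuple r).
Qed.

Lemma len1 : len 1 = 0%N.
Proof. by apply/eqP; have:= len_wprod [::]; rewrite /wprod big_nil leqn0. Qed.

Lemma lenM x y : len (x * y) <= len x + len y.
Proof.
have [[r <- <-] [t <- <-]] := (redw x, redw y).
by rewrite -wprod_cat -size_cat len_wprod.
Qed.

Lemma lenV x : len x^-1 = len x.
Proof.
suff H y : len y^-1 <= len y by apply/eqP; rewrite eqn_leq H -{1}[x]invgK H.
by have [r <- <-] := redw y; rewrite -wprod_rev -(size_rev r) len_wprod.
Qed.

Lemma len_gen i : len (s i) <= 1.
Proof.
by have := len_wprod [:: i]; rewrite wprod_cons /wprod big_nil mulg1.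
Qed.

(* The signed permutation representation on W x {+1, -1}, and exchange. *)
Definition sgn_fun i (p : W * bool) := (p.1 ^ s i, p.2 (+) (p.1 == s i)).

Lemma sgn_funK i : involutive (sgn_fun i).
Proof.
move=> [t e]; rewrite /sgn_fun /= -conjgM gen2 conjg1.
rewrite (canF_eq (conjgK _)) genV /conjg genV gen2 mulg1 -addbA addbb.
by rewrite addbF.
Qed.

Definition sgn_perm i := perm (can_inj (sgn_funK i)).

Fixpoint sgn_cnt r (t : W) : bool :=
  if r is i :: r' then (t == s i) (+) sgn_cnt r' (t ^ s i) else false.

Lemma sgn_prod r t e :
  (\prod_(i <- r) sgn_perm i) (t, e) = (t ^ wprod r, e (+) sgn_cnt r t).
Proof.
elim: r t e => [|i r IHr] t e.
  by rewrite big_nil perm1 /wprod big_nil conjg1 addbF.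
by rewrite big_cons permM permE /sgn_fun IHr /= wprod_cons conjgM addbA.
Qed.

Lemma sgn_cnt_cat r1 r2 t :
  sgn_cnt (r1 ++ r2) t = sgn_cnt r1 t (+) sgn_cnt r2 (t ^ wprod r1).
Proof.
elim: r1 t => [|i r IHr] t /=; first by rewrite /wprod big_nil conjg1.
by rewrite IHr wprod_cons conjgM addbA.
Qed.

Definition alt i j n := flatten (nseq n [:: i; j]).

Lemma altS i j n : alt i j n.+1 = i :: j :: alt i j n. Proof. by []. Qed.

Lemma wprod_alt i j n : wprod (alt i j n) = (s i * s j) ^+ n.
Proof.
elim: n => [|n IHn]; first by rewrite /wprod big_nil.
by rewrite altS !wprod_cons IHn expgS mulgA.
Qed.

(* [t] occurs as a reflection of the alternating word as often as among
   (s_i s_j)^k s_i, k < 2n *)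
Lemma sgn_cnt_alt i j n t : sgn_cnt (alt i j n) t =
  odd (count (fun k => t == (s i * s j) ^+ k * s i) (iota 0 (n + n))).
Proof.
elim: n t => [|n IHn] t //.
rewrite altS addSn addnS /= IHn expg0 mul1g !oddD expg1 !oddb.
congr (_ (+) (_ (+) _)).
  by rewrite (canF_eq (conjgK _)) conjgE !genV mulgA.
rewrite -(addn0 2) (iotaDl 2 0) count_map; congr (odd _).
apply: eq_count => k /=; rewrite add2n -conjgM (canF_eq (conjgK _)).
by rewrite conjgE invgK invMg !genV expgS expgSr -!mulgA.
Qed.

Lemma sgn_perm_rel i j : (sgn_perm i * sgn_perm j) ^+ cox_mat i j = 1.
Proof.
set m := cox_mat i j.
have <- : \prod_(k <- alt i j m) sgn_perm k = (sgn_perm i * sgn_perm j) ^+ m.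
  elim: m => [|n IHn]; first by rewrite big_nil.
  by rewrite altS !big_cons IHn expgS mulgA.
apply/permP=> -[t e]; rewrite sgn_prod perm1 wprod_alt cox_rel conjg1.
rewrite sgn_cnt_alt iotaD count_cat add0n -{2}(addn0 m) iotaDl count_map.
set f := count _ _; set g := count _ _.
have -> : g = f.
  by apply: eq_count => k /=; rewrite expgD cox_rel mul1g.
by rewrite oddD addbb addbF.
Qed.

Lemma sgn_cnt_eq r1 r2 t : wprod r1 = wprod r2 -> sgn_cnt r1 t = sgn_cnt r2 t.
Proof.
have [phi phiM phis] := cox_univ sgn_perm_rel => E.
have phi1 : phi 1 = 1 by apply: (mulgI (phi 1)); rewrite -phiM !mulg1.
have phiP r : phi (wprod r) = \prod_(i <- r) sgn_perm i.
  by rewrite (big_morph _ phiM phi1); apply: eq_bigr => k _.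
have := sgn_prod r1 t false; rewrite -phiP E phiP sgn_prod => -[].
by move->.
Qed.

Lemma sgn_cnt_del r t : sgn_cnt r t ->
  exists r1 i r2, r = r1 ++ i :: r2 /\ t * wprod r = wprod (r1 ++ r2).
Proof.
elim: r t => [|i r IHr] t //=; case: eqP => [-> _|_ /= /IHr].
  by exists [::], i, r; rewrite wprod_cons mulKgen.
case=> r1 [j [r2 [-> E]]]; exists (i :: r1), j, r2; split=> //.
rewrite [RHS]wprod_cons -E wprod_cons conjgE genV !mulgA gen2.
by rewrite mul1g.
Qed.

Lemma len_del r1 i r2 : len (wprod (r1 ++ r2)) < size (r1 ++ i :: r2).
Proof. by rewrite (leq_ltn_trans (len_wprod _)) // !size_cat addnS. Qed.

Lemma exchL i w r : len (s i * w) < len w -> wprod r = w ->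
  exists r1 j r2, r = r1 ++ j :: r2 /\ s i * w = wprod (r1 ++ r2).
Proof.
move=> lt_w def_w; have [r0 r0P r0s] := redw (s i * w).
suff : sgn_cnt r (s i).
  by case/sgn_cnt_del=> r1 [j [r2]]; rewrite def_w; exists r1, j, r2.
have -> : sgn_cnt r (s i) = sgn_cnt (i :: r0) (s i).
  by apply: sgn_cnt_eq; rewrite wprod_cons r0P mulKgen.
rewrite /= eqxx conjgE genV mulKgen.
apply/negP => /sgn_cnt_del[r1 [j [r2 [E]]]].
rewrite r0P mulKgen => Ew; have := len_del r1 j r2.
by rewrite -E -Ew r0s ltnNge ltnW.
Qed.

Lemma len_neqL i w : len (s i * w) != len w.
Proof.
have [r0 r0P r0s] := redw w; have [r1 r1P r1s] := redw (s i * w).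
have lt_del r x : wprod r = x -> size r = len x -> sgn_cnt r (s i) ->
    len (s i * x) < len x.
  move=> <- <- /sgn_cnt_del[a [j [b [E ->]]]].
  by rewrite [r in size r]E len_del.
have E : sgn_cnt r1 (s i) = ~~ sgn_cnt r0 (s i).
  have -> : sgn_cnt r1 (s i) = sgn_cnt (i :: r0) (s i).
    by apply: sgn_cnt_eq; rewrite wprod_cons r0P.
  by rewrite /= eqxx conjgE genV mulKgen.
case: (boolP (sgn_cnt r0 (s i))) => [/(lt_del _ _ r0P r0s)|].
  by rewrite ltn_neqAle => /andP[].
rewrite -E => /(lt_del _ _ r1P r1s); rewrite mulKgen.
by rewrite ltn_neqAle eq_sym => /andP[].
Qed.

Lemma len_genL i w : len (s i * w) =
  if len (s i * w) < len w then (len w).-1 else (len w).+1.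
Proof.
have := len_neqL i w; have := lenM (s i) w; have := len_gen i.
have := lenM (s i) (s i * w); rewrite mulKgen; case: ifP; lia.
Qed.

Lemma len_genR i w : len (w * s i) =
  if len (w * s i) < len w then (len w).-1 else (len w).+1.
Proof.
by have := len_genL i w^-1; rewrite -[s i * w^-1]invgK invMg invgK genV !lenV.
Qed.

Lemma gen_neq1 i : s i != 1.
Proof. by apply/eqP => E; have := len_neqL i 1; rewrite mulg1 E eqxx. Qed.

Lemma descR1 i : i \in descR 1 = false.
Proof. by rewrite inE len1 ltn0. Qed.

Lemma descR_gen i : i \in descR (s i).
Proof.
rewrite inE gen2 len1 lt0n; apply/eqP=> E; have := len_neqL i 1.
by rewrite mulg1 E len1.
Qed.

Lemma descR_mul i w : (i \in descR (w * s i)) = (i \notin descR w).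
Proof. by rewrite !inE mulgenK; have := len_genR i w; case: ifP; lia. Qed.

Lemma exchR i w r : i \in descR w -> wprod r = w ->
  exists r1 j r2, r = r1 ++ j :: r2 /\ w * s i = wprod (r1 ++ r2).
Proof.
rewrite inE -(lenV (w * _)) -(lenV w) invMg genV => lt_w def_w.
have [|r1 [j [r2 [E Ew]]]] := exchL (r := rev r) lt_w.
  by rewrite wprod_rev def_w.
exists (rev r2), j, (rev r1); split.
  by rewrite -[r]revK E rev_cat rev_cons cat_rcons.
by rewrite -rev_cat wprod_rev -Ew invMg invgK genV.
Qed.

Lemma cat_split (b r r1 r2 : seq I) j : b ++ r = r1 ++ j :: r2 ->
  (exists b2, b = r1 ++ j :: b2 /\ r2 = b2 ++ r) \/
  (exists r1', r1 = b ++ r1' /\ r = r1' ++ j :: r2).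
Proof.
elim: b r1 => [|k b IHb] [|l r1] /=; first by right; exists [::].
- by right; exists (l :: r1).
- by case=> -> <-; left; exists b.
case=> -> /IHb[[b2 [-> ->]]|[r1' [-> ->]]]; first by left; exists b2.
by right; exists r1'.
Qed.

(* [len (y * x^-1)] is a distance on W; moving exactly one of two points
   along s_i in the direction of the other strictly decreases it *)
Lemma dist_lt i x y : (i \in descR x) != (i \in descR y) ->
  len (y * s i * x^-1) < len (y * x^-1).
Proof.
wlog : x y / i \in descR y => [hwlog|iy].
  case iy: (i \in descR y); first by move=> ne; apply: hwlog; rewrite ?iy.
  case ix: (i \in descR x) => // _.
  by have := hwlog y x; rewrite -lenV -(lenV (x * _)) !invMg !invgK genV mulgA
     ix iy; apply.
rewrite iy => /eqP; case ix: (i \in descR x) => // _.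
have [b bP bs] := redw (y * x^-1); have [r rP rs] := redw x.
have [|r1 [j [r2 [E Ey]]]] := exchR (r := b ++ r) iy.
  by rewrite wprod_cat bP rP mulgKV.
rewrite Ey -bs; case: (cat_split E) => [[b2 [Eb ->]]|[r1' [Er1 Er]]].
  by rewrite catA wprod_cat rP mulgK Eb; exact: len_del.
have : x * s i = wprod (r1' ++ r2).
  apply: (mulgI (wprod b)); rewrite -wprod_cat catA -Er1 -Ey bP.
  by rewrite mulgA mulgKV.
move=> Ex; move: ix; rewrite inE Ex -rs Er => /negP[]; exact: len_del.
Qed.

Lemma longest_ex : {w0 : W | forall x, len x <= len w0}.
Proof.
by exists [arg max_(x > 1) len x]; case: arg_maxnP => // x _ + y; apply.
Qed.

Lemma len_longest w0 : (forall x, len x <= len w0) ->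
  forall x, (len (w0 * x) + len x = len w0)%N.
Proof.
move=> w0max.
suff le0 x : (len x + len (x^-1 * w0) = len w0)%N.
  by move=> x; rewrite -(le0 (w0 * x)) invMg -mulgA mulVg mulg1 lenV.
have [n le_n] := ubnP (len x); elim: n => // n IHn in x le_n *.
have [[|j r] rP rs] := redw x.
  by rewrite -rP /wprod big_nil len1 invg1 mul1g.
pose x' := wprod r; have Ex : x = s j * x' by rewrite -rP wprod_cons.
have x's : len x' = size r.
  have := len_wprod r; rewrite -/x'; have := lenM (s j) x'.
  by rewrite -Ex -rs /=; have := len_gen j; lia.
have IHx' : (len x' + len (x'^-1 * w0) = len w0)%N.
  by apply: IHn; rewrite x's; move: le_n; rewrite -rs /=.
have [y yP ys] := redw (x'^-1 * w0).
have jw0 : len (s j * w0) < len w0 by rewrite ltn_neqAle len_neqL w0max.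
have [|r1 [k [r2 [E Ew]]]] := exchL (r := r ++ y) jw0.
  by rewrite wprod_cat yP mulKVg.
case: (cat_split E) => [[b2 [Er Er2]]|[r1' [Er1 Ey]]].
  have Ex2 : x = wprod (r1 ++ b2).
    apply: (mulIg (wprod y)).
    by rewrite -wprod_cat -catA -Er2 -Ew yP Ex -mulgA mulKVg.
  by have := len_del r1 k b2; rewrite -Ex2 -Er -rs /= ltnNge ltnW.
have Exw : x^-1 * w0 = wprod (r1' ++ r2).
  apply: (mulgI x); rewrite mulKVg Ex -mulgA /x' -wprod_cat catA -Er1 -Ew.
  by rewrite mulKgen.
have := len_del r1' k r2; rewrite -Ey -Exw ys.
have := lenM x (x^-1 * w0); rewrite mulKVg -IHx' -rs /= x's; lia.
Qed.

Lemma leR1 w : leR 1 w.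
Proof. by rewrite /leR len1 invg1 mul1g. Qed.

Lemma leR_desc u w i : leR u w -> i \in descR u -> leR (u * s i) w.
Proof.
rewrite /leR inE => /eqP luw iu; rewrite invMg genV -mulgA.
have := lenM (u * s i) (s i * (u^-1 * w)).
rewrite (mulgA (u * s i)) mulgenK mulKVg.
have := len_genR i u; have := len_genL i (u^-1 * w); rewrite iu.
by case: ifP => _ -> ->; lia.
Qed.

(* ** The biHecke monoid; functions act on the right, so that the product
   of f and g is "f, then g" *)
Definition bh_pi i : {ffun W -> W} :=
  [ffun w => if i \in descR w then w else w * s i].

Definition bh_opi i : {ffun W -> W} :=
  [ffun w => if i \in descR w then w * s i else w].

Definition ffun_mul (f g : {ffun W -> W}) : {ffun W -> W} :=
  [ffun w => g (f w)].

Definition bh_closed (A : {set {ffun W -> W}}) : bool :=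
  [&& [ffun w => w] \in A,
      [forall f in A, forall g in A, ffun_mul f g \in A] &
      [forall i, (bh_pi i \in A) && (bh_opi i \in A)]].

Definition bh_set : {set {ffun W -> W}} := \bigcap_(A | bh_closed A) A.

Definition biHecke := {f : {ffun W -> W} | f \in bh_set}.

HB.instance Definition _ := Finite.on biHecke.

Lemma bh_setP f : reflect (forall A, bh_closed A -> f \in A) (f \in bh_set).
Proof. exact: bigcapP. Qed.

Lemma bh_closed_set : bh_closed bh_set.
Proof.
apply/and3P; split; first by apply/bh_setP => A /and3P[].
- apply/'forall_in_forall_inP => f /bh_setP fM g /bh_setP gM.
  apply/bh_setP => A cA; have /and3P[_ /'forall_in_forall_inP H _] := cA.
  by apply: H; [apply: fM | apply: gM].
apply/forallP => i; apply/andP.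
by split; apply/bh_setP => A /and3P[_ _ /forallP/(_ i)/andP[]].
Qed.

Fact bh_one_subproof : [ffun w : W => w] \in bh_set.
Proof. by case/and3P: bh_closed_set. Qed.

Fact bh_mul_subproof (f g : biHecke) : ffun_mul (val f) (val g) \in bh_set.
Proof.
case/and3P: bh_closed_set => _ /'forall_in_forall_inP H _.
by apply: H; apply: valP.
Qed.

Fact bh_pi_subproof i : bh_pi i \in bh_set.
Proof. by case/and3P: bh_closed_set => _ _ /forallP/(_ i)/andP[]. Qed.

Fact bh_opi_subproof i : bh_opi i \in bh_set.
Proof. by case/and3P: bh_closed_set => _ _ /forallP/(_ i)/andP[]. Qed.

Definition bh_one : biHecke := Sub [ffun w : W => w] bh_one_subproof.
Definition bh_mul (f g : biHecke) : biHecke :=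
  Sub (ffun_mul (val f) (val g)) (bh_mul_subproof f g).

(* the letter [inl i] stands for pi_i, [inr i] for its opposite *)
Definition bh_gen (c : I + I) : biHecke :=
  match c with
  | inl i => Sub (bh_pi i) (bh_pi_subproof i)
  | inr i => Sub (bh_opi i) (bh_opi_subproof i)
  end.

Fact bh_mulA : associative bh_mul.
Proof. by move=> f g h; apply/val_inj/ffunP => w; rewrite !ffunE. Qed.

Fact bh_mul1 : left_id bh_one bh_mul.
Proof. by move=> f; apply/val_inj/ffunP => w; rewrite !ffunE. Qed.

Fact bh_mulr1 : right_id bh_one bh_mul.
Proof. by move=> f; apply/val_inj/ffunP => w; rewrite !ffunE. Qed.

Lemma bh_inj (f : biHecke) : injective (val f) -> f = bh_one.
Proof.
move=> f_inj; apply/val_inj.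
pose A := [set g : {ffun W -> W} | (g == [ffun w => w]) || ~~ injectiveb g].
suff cA : bh_closed A.
  have /bh_setP/(_ A cA) := valP f; rewrite inE => /orP[/eqP //|].
  by move/injectiveP.
apply/and3P; split; first by rewrite inE eqxx.
- apply/'forall_in_forall_inP => g + h; rewrite !inE.
  case/orP=> [/eqP->|g_ninj]; case/orP=> [/eqP->|h_ninj].
  + by apply/orP; left; apply/eqP/ffunP=> w; rewrite !ffunE.
  + suff -> : ffun_mul [ffun w => w] h = h by rewrite h_ninj orbT.
    by apply/ffunP=> w; rewrite !ffunE.
  + suff -> : ffun_mul g [ffun w => w] = g by rewrite g_ninj orbT.
    by apply/ffunP=> w; rewrite !ffunE.
  apply/orP; right; apply: contra g_ninj => /injectiveP gh_inj.
  by apply/injectiveP => x y gxy; apply: gh_inj; rewrite !ffunE gxy.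
apply/forallP=> i; rewrite !inE; apply/andP.
split; apply/orP; right; apply/injectiveP => /(_ 1 (s i));
  rewrite !ffunE descR1 descR_gen ?mul1g ?gen2 => /(_ erefl)/eqP;
  by rewrite eq_sym (negPf (gen_neq1 i)).
Qed.

(* [monomType] asks that 1 be the only invertible element *)
Fact bh_unit f g : bh_mul f g = bh_one -> f = bh_one /\ g = bh_one.
Proof.
move=> fg1; suff f1 : f = bh_one by split=> //; rewrite -fg1 f1 bh_mul1.
apply: bh_inj => x y fxy; have E z : z = val g (val f z).
  by have /(congr1 val)/ffunP/(_ z) := fg1; rewrite !ffunE.
by rewrite (E x) (E y) fxy.
Qed.

HB.instance Definition _ :=
  Choice_isMonomialDef.Build biHecke bh_mulA bh_mul1 bh_mulr1 bh_unit.

Definition bh_word (r : seq (I + I)) : biHecke :=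
  foldr (fun c f => bh_mul (bh_gen c) f) bh_one r.

Lemma bh_word_cat (r1 r2 : seq (I + I)) :
  bh_word (r1 ++ r2) = bh_mul (bh_word r1) (bh_word r2).
Proof. by elim: r1 => [|c r IHr] /=; rewrite ?bh_mul1 // IHr bh_mulA. Qed.

Lemma bh_wordP (f : biHecke) : exists r : seq (I + I), bh_word r == f.
Proof.
pose e (g h : biHecke) := [exists c, h == bh_mul g (bh_gen c)].
have eW g : connect e bh_one g -> exists r : seq (I + I), bh_word r = g.
  case/connectP => p; elim/last_ind: p g => [|p h IHp] g.
    by move=> _ ->; exists [::].
  rewrite rcons_path last_rcons => /andP[/IHp/(_ erefl)[r rP]].
  case/existsP=> c /eqP Eh ->.
  by exists (r ++ [:: c]); rewrite bh_word_cat rP Eh /= bh_mulr1.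
have We (r : seq (I + I)) : connect e bh_one (bh_word r).
  elim/last_ind: r => [|r c IHr] //; apply: connect_trans IHr (connect1 _).
  by apply/existsP; exists c; rewrite -cats1 bh_word_cat /= bh_mulr1.
pose A := [set val g | g in connect e bh_one].
suff cA : bh_closed A.
  have /bh_setP/(_ A cA)/imsetP[g] := valP f.
  by rewrite inE => /eW[r <-] /val_inj ->; exists r.
apply/and3P; split; first by apply/imsetP; exists bh_one; rewrite ?inE.
- apply/'forall_in_forall_inP => _ /imsetP[g + ->] _ /imsetP[h + ->].
  rewrite !inE => /eW[r <-] /eW[t <-]; apply/imsetP.
  by exists (bh_word (r ++ t)); rewrite ?inE ?We // bh_word_cat.
apply/forallP=> i; apply/andP; split; apply/imsetP.
  by exists (bh_gen (inl i)); rewrite ?inE //; have := We [:: inl i];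
    rewrite /= bh_mulr1.
by exists (bh_gen (inr i)) => //; have := We [:: inr i]; rewrite /= bh_mulr1.
Qed.

Section Translation.
Variable w : W.

Definition intervalR := {u : W | leR u w}.
HB.instance Definition _ := Finite.on intervalR.

(* action of pi_i and of its opposite on the basis, [None] being 0; note that
   [insub x] is [Some x] if x lies in [1, w]_R and [None] otherwise *)
Definition trans_gen (c : I + I) (u : intervalR) : option intervalR :=
  match c with
  | inl i => if i \in descR (val u) then Some u else insub (val u * s i)
  | inr i => if i \in descR (val u) then insub (val u * s i) : option intervalR
             else if leR (val u * s i) w then Some u else None
  end.

Definition trans_word (r : seq (I + I)) (u : intervalR) : option intervalR :=
  foldl (fun o c => obind (trans_gen c) o) (Some u) r.

(* f acts as any word in the generators which represents it; by
   [trans_word_eq] the choice of the word does not matter *)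
Definition trans_act (f : biHecke) : intervalR -> option intervalR :=
  trans_word (xchoose (bh_wordP f)).

Lemma bh_gen_dist c x y :
  len (val (bh_gen c) y * (val (bh_gen c) x)^-1) <= len (y * x^-1).
Proof.
have E i : (y * s i) * (x * s i)^-1 = y * x^-1.
  by rewrite invMg genV mulgA mulgenK.
have E' i : y * (x * s i)^-1 = y * s i * x^-1 by rewrite invMg genV mulgA.
have D i := @dist_lt i x y.
case: c => i; rewrite /= !ffunE; move: (D i); case: ifP; case: ifP => _ _;
  rewrite ?E ?E' // => /(_ erefl)/ltnW //.
Qed.

Lemma bh_gen_dist_lt i c x y : c = inl i \/ c = inr i ->
  (i \in descR x) != (i \in descR y) ->
  len (val (bh_gen c) y * (val (bh_gen c) x)^-1) < len (y * x^-1).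
Proof.
have E' : y * (x * s i)^-1 = y * s i * x^-1 by rewrite invMg genV mulgA.
move=> ci D; have:= dist_lt D; case: ci => ->; rewrite /= !ffunE; move: D;
  by case: ifP; case: ifP => // _ _ _; rewrite ?E'.
Qed.

Section Top.
Variables (w0 : W) (w0P : forall x, len x <= len w0).
Let a := w0 * w^-1.

Lemma descR_top i v :
  (i \in descR (a * v)) = ~~ (len ((v * s i)^-1 * w) < len (v^-1 * w)).
Proof.
have E u : len (u^-1 * w) = len (w^-1 * u) by rewrite -lenV invMg invgK.
have E1 : a * v = w0 * (w^-1 * v) by rewrite mulgA.
rewrite !E inE E1 -mulgA (mulgA w^-1); set x := w^-1 * v.
have := len_longest w0P x; have := len_longest w0P (x * s i).
have := len_genR i x; set p := len (w0 * (x * s i)); set q := len (x * s i).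
set n := len (w0 * x) => A B C.
case: ifP A => lt_q A /=; last by apply/idP; lia.
by apply/negbTE; rewrite -leqNgt; lia.
Qed.

Lemma descR_top1 i v : leR v w -> i \in descR v -> i \in descR (a * v).
Proof.
move=> lvw iv; rewrite descR_top; have lvs := leR_desc lvw iv; move: lvs lvw iv.
rewrite /leR inE; set p := len (_ * w); set q := len (v^-1 * w).
by set n := len (v * s i); lia.
Qed.

Lemma descR_top2 i v : leR v w -> i \notin descR v ->
  (i \in descR (a * v)) = ~~ leR (v * s i) w.
Proof.
move=> lvw iv; rewrite descR_top; congr (~~ _); move: lvw iv.
rewrite /leR inE; have := len_genR i v; have := len_genL i (v^-1 * w).
have -> : s i * (v^-1 * w) = (v * s i)^-1 * w by rewrite invMg genV mulgA.
set p := len (_^-1 * w); set q := len (v^-1 * w).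
set n := len (v * s i); case: ifP => lt_p Ep; case: ifP => // lt_n En lw _.
  by apply/esym/eqP; rewrite En Ep (eqP lw); lia.
by apply/esym/negbTE; rewrite En Ep (eqP lw); lia.
Qed.

Lemma trans_gen_top c (v : intervalR) :
  if trans_gen c v is Some v' then
    val (bh_gen c) (val v) = val v' /\
    val (bh_gen c) (a * val v) = a * val v'
  else len (val (bh_gen c) (a * val v) * (val (bh_gen c) (val v))^-1) < len a.
Proof.
have lvw := valP v.
have aE : a = a * val v * (val v)^-1 by rewrite mulgK.
case: c => i /=; case: ifP => iv.
- by rewrite !ffunE iv (descR_top1 lvw iv).
- have iav := descR_top2 lvw (negbT iv).
  case: insubP => [v' + ->|lv'] /=.
    by move=> lv'; rewrite !ffunE iv iav lv' /= mulgA.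
  rewrite [X in _ < len X]aE.
  apply: (bh_gen_dist_lt (i := i) (c := inl i)); first by left.
  by rewrite iv iav lv'.
- rewrite insubT ?leR_desc // => lv' /=.
  by rewrite !ffunE iv (descR_top1 lvw iv) mulgA.
have iav := descR_top2 lvw (negbT iv); case: ifP => lv'.
  by rewrite !ffunE iv iav lv'.
rewrite [X in _ < len X]aE.
apply: (bh_gen_dist_lt (i := i) (c := inr i)); first by right.
by rewrite iv iav lv'.
Qed.

Lemma trans_word_top (r : seq (I + I)) (u : intervalR) :
  if trans_word r u is Some v then
    val (bh_word r) (val u) = val v /\ val (bh_word r) (a * val u) = a * val v
  else len (val (bh_word r) (a * val u) * (val (bh_word r) (val u))^-1) < len a.
Proof.
elim/last_ind: r => [|r c]; first by rewrite /= !ffunE.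
have E x : val (bh_word (rcons r c)) x = val (bh_gen c) (val (bh_word r) x).
  rewrite -cats1 bh_word_cat (_ : bh_word [:: c] = bh_gen c) ?ffunE //.
  exact: bh_mulr1.
rewrite /trans_word -cats1 foldl_cat -/(trans_word r u) /= cats1 !E.
case: (trans_word r u) => [v [-> ->]|lt_a] /=; first exact: trans_gen_top.
exact: leq_ltn_trans (bh_gen_dist _ _ _) lt_a.
Qed.

End Top.

Lemma trans_word_eq (r1 r2 : seq (I + I)) : bh_word r1 = bh_word r2 ->
  trans_word r1 =1 trans_word r2.
Proof.
have [w0 w0P] := longest_ex => E u.
have := trans_word_top w0P r1 u; have := trans_word_top w0P r2 u; rewrite -E.
case: (trans_word r1 u) (trans_word r2 u) => [v1|] [v2|] //.
- by case=> -> _ [/val_inj-> _].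
- by move=> + [E1 E2]; rewrite E1 E2 mulgK ltnn.
by case=> -> ->; rewrite mulgK ltnn.
Qed.

Lemma trans_actE (r : seq (I + I)) : trans_act (bh_word r) =1 trans_word r.
Proof. by apply: trans_word_eq; apply/eqP; apply: (xchooseP (bh_wordP _)). Qed.

Lemma trans_act_gen c : trans_act (bh_gen c) =1 trans_gen c.
Proof. by move=> u; rewrite -(bh_mulr1 (bh_gen c)) (trans_actE [:: c]). Qed.

Lemma trans_act1 (u : intervalR) : trans_act bh_one u = Some u.
Proof. by rewrite (trans_actE [::]). Qed.

Lemma trans_actM f g (u : intervalR) :
  trans_act (bh_mul f g) u = obind (trans_act g) (trans_act f u).
Proof.
have [[r /eqP<-] [t /eqP<-]] := (bh_wordP f, bh_wordP g).
rewrite -bh_word_cat !trans_actE /trans_word foldl_cat -/(trans_word r u).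
case: (trans_word r u) => [v|] /=; first by rewrite trans_actE.
by elim: t.
Qed.

End Translation.

End Coxeter.

Import GRing.Theory.
Local Open Scope ring_scope.

Section TranslationModule.
Variables (K : fieldType) (W : finCoxeterSystem).

Definition bh_algebra := {malg K[biHecke W]}.
HB.instance Definition _ := GRing.NzRing.on bh_algebra.

Variable w : W.

Definition transmod := {ffun intervalR w -> K}.
HB.instance Definition _ := GRing.Zmodule.on transmod.
Implicit Types (a b : bh_algebra) (v : transmod).

Definition transmod_act a v : transmod :=
  [ffun x => \sum_(f : biHecke W)
               \sum_(u | trans_act f u == Some x) a@_f * v u].

Fact transmod_actDr a : {morph transmod_act a : v1 v2 / v1 + v2}.
Proof.
move=> v1 v2; apply/ffunP=> x; rewrite !ffunE -big_split /=.
apply: eq_bigr => f _; rewrite -big_split /=.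
by apply: eq_bigr => u _; rewrite ffunE mulrDr.
Qed.

Fact transmod_actDl v : {morph transmod_act^~ v : a b / a + b}.
Proof.
move=> a b; apply/ffunP=> x; rewrite !ffunE -big_split /=.
apply: eq_bigr => f _; rewrite -big_split /=.
by apply: eq_bigr => u _; rewrite mcoeffD mulrDl.
Qed.

Fact transmod_act1 : left_id 1 transmod_act.
Proof.
move=> v; apply/ffunP=> x; 
  rewrite ffunE (bigD1 (bh_one W)) //= [X in _ + X]big1 ?addr0.
  rewrite (big_pred1 x) => [|u]; last by rewrite trans_act1 /= eqE.
  by rewrite mcoeff1 eqxx mul1r.
by move=> f /negPf f1; rewrite big1 // => u _; rewrite mcoeff1 f1 mul0r.
Qed.

Fact transmod_actM a b v :
  transmod_act b (transmod_act a v) = transmod_act (a * b) v.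
Proof.
have msuppE c (F : biHecke W -> K) : (forall f, c@_f = 0 -> F f = 0) ->
    \sum_(f <- msupp (c : bh_algebra)) F f = \sum_f F f.
  move=> F0; rewrite big_uniq ?fset_uniq //= big_mkcond; apply: eq_bigr => f _.
  by case: (msuppP c) => // f_c; rewrite F0 ?mcoeff_outdom.
have mulE h : (a * b)@_h = \sum_f \sum_g (a@_f * b@_g) *+ (bh_mul f g == h).
  rewrite mcoeffMl msuppE => [|f af0]; last first.
    by rewrite big1 // => g _; rewrite af0 mul0r mul0rn.
  apply: eq_bigr => f _; rewrite msuppE // => g bg0.
  by rewrite bg0 mulr0 mul0rn.
apply/ffunP=> x; rewrite !ffunE.
transitivity (\sum_f \sum_g \sum_(u | trans_act (bh_mul f g) u == Some x)
                a@_f * b@_g * v u).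
  rewrite exchange_big /=; apply: eq_bigr => g _.
  under eq_bigr => u _ do rewrite ffunE big_distrr /=.
  rewrite exchange_big /=; apply: eq_bigr => f _.
  under eq_bigr => u _ do rewrite big_distrr /=.
  rewrite (exchange_big_dep
            (fun u => trans_act (bh_mul f g) u == Some x)) /=; last first.
    by move=> y u /eqP gy /eqP fu; rewrite trans_actM fu /= gy.
  apply: eq_bigr => u; rewrite trans_actM.
  case: (trans_act f u) => //= y gyx; rewrite (big_pred1 y) => [|z].
    by rewrite mulrCA mulrA.
  rewrite (_ : (Some y == Some z) = (z == y)) /=; last by rewrite eq_sym.
  by case: (eqVneq z y) => [->|_]; rewrite ?gyx ?andbF.
under [RHS]eq_bigr => h _.
  under eq_bigr => u _ do rewrite mulE big_distrl /=.
  rewrite exchange_big /=; over.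
rewrite [RHS]exchange_big /=; apply: eq_bigr => f _.
under [RHS]eq_bigr => h _.
  under eq_bigr => u _ do rewrite big_distrl /=.
  rewrite exchange_big /=; over.
rewrite [RHS]exchange_big /=; apply: eq_bigr => g _.
rewrite (bigD1 (bh_mul f g)) //= [X in _ + X]big1 ?addr0; last first.
  move=> h /negPf; rewrite eq_sym => neq; rewrite big1 // => u _.
  by rewrite neq mul0r.
by apply: eq_bigr => u _; rewrite eqxx.
Qed.

(* Right modules over a ring A are modules over the converse ring A^c; in
   [a *: v] with [a : A^c] the scalar a acts on the right. *)
Fact transmod_scaleA (a b : bh_algebra^c) v :
  transmod_act a (transmod_act b v) = transmod_act (a * b) v.
Proof. exact: transmod_actM. Qed.

HB.instance Definition _ := GRing.Zmodule_isLmodule.Build bh_algebra^c transmod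
  transmod_scaleA transmod_act1 transmod_actDr transmod_actDl.

Definition transmod_basis (u : intervalR w) : transmod :=
  [ffun x => (x == u)%:R].

Lemma transmod_basisE f u :
  (<< f >> : bh_algebra^c) *: transmod_basis u =
  oapp transmod_basis 0 (trans_act f u).
Proof.
apply/ffunP=> x; rewrite ffunE (bigD1 f) //= [X in _ + X]big1 ?addr0.
  under eq_bigr => y _ do rewrite mcoeffUU mul1r ffunE.
  rewrite big_mkcond (bigD1 u) //= eqxx big1 ?addr0 => [|y /negPf->].
    case: (trans_act f u) => [y|] /=; rewrite ffunE // [in RHS]eq_sym.
    by rewrite (_ : (Some y == Some x) = (y == x)) //; case: eqP.
  by rewrite if_same.
move=> g; rewrite eq_sym => /negPf fg; rewrite big1 // => y _.
by rewrite mcoeffU fg mul0r.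
Qed.

Lemma transmod_gen c u :
  (<< bh_gen c >> : bh_algebra^c) *: transmod_basis u =
  oapp transmod_basis 0 (trans_gen c u).
Proof. by rewrite transmod_basisE trans_act_gen. Qed.

End TranslationModule.

Section ModuleNotions.
Variable R : nzRingType.
Implicit Types V P : lmodType R.

Definition submodule V (U : V -> Prop) : Prop :=
  [/\ U 0, forall x y, U x -> U y -> U (x + y)
      & forall (a : R) x, U x -> U (a *: x)].

Definition zero_sub V (U : V -> Prop) : Prop := forall x, U x -> x = 0.

Definition full_sub V (U : V -> Prop) : Prop := forall x, U x.

Definition simple_module V : Prop :=
  (exists x : V, x <> 0) /\
  forall U : V -> Prop, submodule U -> zero_sub U \/ full_sub U.

Definition indecomposable V : Prop :=
  (exists x : V, x <> 0) /\
  forall U1 U2 : V -> Prop, submodule U1 -> submodule U2 ->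
    (forall x, exists x1 x2, [/\ U1 x1, U2 x2 & x = x1 + x2]) ->
    (forall x, U1 x -> U2 x -> x = 0) ->
    zero_sub U1 \/ zero_sub U2.

Definition surjective V P (f : V -> P) : Prop := forall y, exists x, f x = y.

Definition is_quotient V P : Prop :=
  exists f : {linear V -> P}, surjective f.

Definition projective P : Prop :=
  forall (V1 V2 : lmodType R) (g : {linear V1 -> V2}) (f : {linear P -> V2}),
    surjective g -> exists h : {linear P -> V1}, forall x, g (h x) = f x.

Definition maximal_submodule V (U : V -> Prop) : Prop :=
  [/\ submodule U, ~ full_sub U
    & forall U' : V -> Prop, submodule U' -> (forall x, U x -> U' x) ->
        full_sub U' \/ (forall x, U' x -> U x)].

Definition module_rad V (x : V) : Prop :=
  forall U : V -> Prop, maximal_submodule U -> U x.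

(* S is isomorphic to V / rad V *)
Definition is_top V (S : lmodType R) : Prop :=
  exists2 q : {linear V -> S},
    surjective q & forall x, q x = 0 <-> module_rad x.

End ModuleNotions.

(* S is the simple module S_w = T_w / rad T_w *)
Definition is_simple_of (K : fieldType) (W : finCoxeterSystem) (w : W)
    (S : lmodType (bh_algebra K W)^c) : Prop :=
  simple_module S /\ is_top (transmod K w) S.

(* P is the indecomposable projective module P_w, whose top is S_w *)
Definition is_proj_of (K : fieldType) (W : finCoxeterSystem) (w : W)
    (P : lmodType (bh_algebra K W)^c) : Prop :=
  [/\ indecomposable P, projective P &
      exists2 S : lmodType (bh_algebra K W)^c, is_simple_of w S & is_top P S].

(* Main.v *)
(* Let b be the basis vector of T_w at the identity; it generates T_w. Acting
   by pi_i along a reduced word of w sends every basis vector to w or to 0, and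
   the opposite letters then bring w back to 1, so some e in M fixes b and
   satisfies T_w e = K b. Hence a submodule U with U e <> 0 contains b and is
   all of T_w, so N = {x | x a e = 0 for all a} is the largest proper submodule:
   T_w is indecomposable and T_w / rad T_w = T_w / N is simple.
   For the projective cover, take u in KM fixing b such that multiplication by
   u has minimal rank. The right ideal u KM is generated by an idempotent f
   fixing b, and by minimality a submodule of f KM whose image in T_w is all of
   T_w equals f KM; so the preimage of N is the largest proper submodule of
   f KM.
   Finally a projective module with top T_w / N maps to T_w by lifting, and the
   image, not being contained in N, is T_w. *)
Require Import Defs.
From HB Require Import structures.
From mathcomp Require Import all_boot all_order all_algebra all_fingroup.
From mathcomp Require Import monalg zify boolp.

Set Implicit Arguments.
Unset Strict Implicit.
Unset Printing Implicit Defensive.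

(** * Words in the [pi_i] acting on [[1, w]_R] *)

Section Collapse.
Variable W : finCoxeterSystem.
Local Notation I := (cox_index W).
Local Notation s := (@cox_gen W).
Import GroupScope.

Definition pi_word (r : seq I) : seq (I + I) := [seq inl i | i <- r].

Lemma bh_word_rcons (r : seq (I + I)) c x :
  val (bh_word (rcons r c)) x = val (bh_gen c) (val (bh_word r) x).
Proof.
rewrite -cats1 bh_word_cat (_ : bh_word [:: c] = bh_gen c) ?ffunE //.
exact: bh_mulr1.
Qed.

(* For x = f 1 and y = f u the claim is x <=_L y. Each letter preserves it,
   because moving only one of two points towards the other shortens y x^-1. *)
Lemma len_pi_word (r : seq I) (u : W) :
  let f := val (bh_word (pi_word r)) in
  len (f u) = (len (f u * (f 1%g)^-1) + len (f 1%g))%N.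
Proof.
elim/last_ind: r => [|r i IHr] /=.
  by rewrite !ffunE invg1 mulg1 len1 addn0.
rewrite /pi_word map_rcons !bh_word_rcons -/(pi_word r).
set g := val (bh_word (pi_word r)); rewrite /= -/g in IHr.
move: (g u) (g 1%g) IHr => y x Eyx; rewrite /= !ffunE.
have lt := @dist_lt W i x y.
have My := lenM (y * s i * x^-1) x; rewrite mulgKV in My.
have Mx := lenM (y * (x * s i)^-1) (x * s i); rewrite mulgKV in Mx.
have Ly := len_genR i y; have Lx := len_genR i x.
have E : y * (x * s i)^-1 = y * s i * x^-1 by rewrite invMg Defs.genV mulgA.
have E2 : (y * s i) * (x * s i)^-1 = y * x^-1.
  by rewrite invMg Defs.genV mulgA mulgenK.
move: lt; case ix: (i \in descR x); case iy: (i \in descR y) => lt;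
  rewrite ?E ?E2 //; rewrite !inE in ix iy; rewrite ix iy ?E in Lx Ly Mx.
(* This case is contradictory: [x <=_L y] makes every right descent of [x] one of [y]. *)
- move: (lt isT) My Ly Eyx; clear; set p := len (_ * x^-1).
  set q := len (y * x^-1); set n := len (y * _); lia.
- move: (lt isT) Mx Lx Eyx; clear; set p := len (_ * x^-1).
  set q := len (y * x^-1); set n := len (x * _); lia.
by rewrite Ly Lx Eyx addnS.
Qed.

Lemma wprod_prefix_leR (r1 r2 : seq I) w : wprod (r1 ++ r2) = w ->
  size (r1 ++ r2) = len w -> leR (wprod r1) w /\ len (wprod r1) = size r1.
Proof.
move=> Ew Es; have := lenM (wprod r1) (wprod r2).
have -> : leR (wprod r1) w = (len w == len (wprod r1) + len (wprod r2))%N.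
  by rewrite /leR -Ew wprod_cat mulKg.
rewrite -wprod_cat Ew -Es size_cat.
have := len_wprod r1; have := len_wprod r2; move=> *; split; last by lia.
by apply/eqP; lia.
Qed.

Variable w : W.
Definition bot : intervalR w := Sub 1%g (leR1 w).

(** Prefixes of a reduced word of [w] stay in [[1, w]_R] and gain length at each letter, so no
    letter gives 0 or acts trivially. *)
Lemma trans_pi_word (r1 r2 : seq I) :
  wprod (r1 ++ r2) = w -> size (r1 ++ r2) = len w ->
  omap val (trans_word (pi_word r1) bot) = Some (wprod r1).
Proof.
elim/last_ind: r1 r2 => [|r i IHr] r2.
  by rewrite /= /wprod big_nil.
move=> Ew Es; have [lrw lr] := wprod_prefix_leR Ew Es.
rewrite cat_rcons in Ew Es; have [_ lr'] := wprod_prefix_leR Ew Es.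
have {IHr} := IHr _ Ew Es.
rewrite /pi_word map_rcons -cats1 /trans_word foldl_cat -/(trans_word _ _).
rewrite -/(pi_word r); case: (trans_word _ _) => //= v [Ev].
have Er : wprod (rcons r i) = val v * s i.
  by rewrite -cats1 wprod_cat -Ev wprod_cons /wprod big_nil mulg1.
rewrite inE -Er lr Ev lr' size_rcons ltnNge leqnSn /=.
by rewrite insubT.
Qed.

Lemma len0 (x : W) : len x = 0%N -> x = 1%g.
Proof. by have [[|i r] <- <-] := redw x; rewrite /wprod ?big_nil. Qed.

Lemma leR_word (u : W) : leR u w ->
  exists r1 r2,
    [/\ wprod r1 = u, wprod (r1 ++ r2) = w & size (r1 ++ r2) = len w].
Proof.
move=> /eqP luw; have [r1 E1 s1] := redw u; have [r2 E2 s2] := redw (u^-1 * w).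
by exists r1, r2; rewrite wprod_cat E1 E2 mulKVg size_cat s1 s2 -luw.
Qed.

Lemma trans_act_from_bot (u : intervalR w) : exists f, trans_act f bot = Some u.
Proof.
have [r1 [r2 [E1 E2 E3]]] := leR_word (valP u).
exists (bh_word (pi_word r1)); rewrite trans_actE.
have := trans_pi_word E2 E3; case: (trans_word _ _) => //= v [].
by rewrite E1 => /val_inj ->.
Qed.

Lemma trans_act_to_bot (u : intervalR w) : exists f, trans_act f u = Some bot.
Proof.
have [n le_n] := ubnP (len (val u)); elim: n => // n IHn in u le_n *.
have [r] := redw (val u); case: (lastP r) => {r} [|r i] Er sr.
  exists (bh_one W); rewrite trans_act1; congr Some; apply: val_inj.
  by rewrite /= -Er /wprod big_nil.
have Eu : val u * s i = wprod r.
  by rewrite -Er -cats1 wprod_cat wprod_cons /wprod big_nil mulg1 mulgenK.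
have iu : i \in descR (val u).
  by rewrite inE Eu -sr size_rcons ltnS len_wprod.
have lv : leR (val u * s i) w := leR_desc (valP u) iu.
have [|f Ef] := IHn (Sub (val u * s i) lv).
  by rewrite /=; move: iu; rewrite inE => /leq_trans; apply.
(* The opposite letter strips the last letter of a reduced word of [u]. *)
exists (bh_mul (bh_gen (inr i)) f).
by rewrite trans_actM trans_act_gen /= iu insubT.
Qed.

Lemma trans_act_collapse : exists2 f : biHecke W, trans_act f bot = Some bot &
  forall u v : intervalR w, trans_act f u = Some v -> v = bot.
Proof.
have [w0 w0P] := longest_ex W.
have lww : leR w w by rewrite /leR mulVg len1 addn0.
pose top : intervalR w := exist _ w lww.
have [r Er sr] := redw w; rewrite -(cats0 r) in Er sr.
have top1 : trans_word (pi_word r) bot = Some top.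
  have := trans_pi_word Er sr; rewrite cats0 in Er.
  case: (trans_word _ _) => //= v [Ev]; congr Some; apply: val_inj.
  by apply: etrans Ev _.
have [g Eg] := trans_act_to_bot top.
exists (bh_mul (bh_word (pi_word r)) g).
  by rewrite trans_actM trans_actE top1.
move=> u v; rewrite trans_actM trans_actE.
case Eu: (trans_word _ u) => [x|] //=.
suff -> : x = top by rewrite Eg => -[].
apply: val_inj => /=.
(* The word sends 1 to [w] and [u] to [x], so [w <=_L x] by [len_pi_word]. As [x <=_R w] bounds the
   length of [x], equality follows. *)
have := trans_word_top w0P (pi_word r) u; rewrite Eu => -[Ex _].
have := trans_word_top w0P (pi_word r) bot; rewrite top1 => -[Ew _].
have := len_pi_word r (val u); have lxw := valP x.
rewrite /= in Ex Ew lxw *; rewrite Ex Ew => E.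
apply: (mulIg w^-1); rewrite mulgV; apply: len0.
move: lxw => /eqP; rewrite E; set p := len (_ * w^-1); set q := len (_ * w).
set n := len w; lia.
Qed.

End Collapse.

Import GRing.Theory.
Local Open Scope quotient_scope.
Local Open Scope ring_scope.

(** * Modules with a largest proper submodule *)

Section Submodules.
Variable R : nzRingType.
Implicit Types V P T : lmodType R.

(** Comparing [N] with every submodule makes it the only maximal one, hence the radical: such a [V]
    is local. *)
Definition largest_proper_sub V (N : V -> Prop) : Prop :=
  [/\ submodule N, ~ full_sub N &
      forall U : V -> Prop, submodule U -> full_sub U \/ forall x, U x -> N x].

Lemma preim_submodule V T (h : {linear V -> T}) (U : T -> Prop) :
  submodule U -> submodule (fun x => U (h x)).
Proof.
case=> U0 UD UZ; split=> [|x y|a x]; rewrite ?linear0 ?linearD ?linearZ //.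
  exact: UD.
exact: UZ.
Qed.

Lemma im_submodule V T (h : {linear V -> T}) (U : V -> Prop) :
  submodule U -> submodule (fun y => exists2 x, U x & h x = y).
Proof.
case=> U0 UD UZ; split=> [|_ _ [x Ux <-] [y Uy <-]|a _ [x Ux <-]].
- by exists 0; rewrite ?linear0.
- by exists (x + y); rewrite ?linearD //; exact: UD.
by exists (a *: x); rewrite ?linearZ //; exact: UZ.
Qed.

Lemma full_submodule V : submodule (fun _ : V => True).
Proof. by []. Qed.

Section Largest.
Variables (V : lmodType R) (N : V -> Prop).
Hypothesis maxN : largest_proper_sub N.

(** Two proper summands would both lie in [N], and so would their sum; if one is full, the other is
    zero. *)
Lemma largest_proper_sub_indecomposable : indecomposable V.
Proof.
have [[N0 ND _] nN maxU] := maxN; split=> [|U1 U2 sU1 sU2 sum12 cap12].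
  have /existsNP[x nx] := nN; exists x => x0; apply: nx; rewrite x0; exact: N0.
have [fU1|U1N] := maxU _ sU1.
  by right=> x; apply: cap12.
have [fU2|U2N] := maxU _ sU2.
  by left=> x U1x; apply: cap12.
case: nN => x; have [x1 [x2 [U1x U2x ->]]] := sum12 x.
by apply: ND; [apply: U1N | apply: U2N].
Qed.

Lemma largest_proper_sub_rad x : module_rad x <-> N x.
Proof.
have [sN nN maxU] := maxN; split=> [|Nx U [sU nU maxU']].
  apply; split=> // U sU _; have [|] := maxU U sU; by [left|right].
have [//|UN] := maxU U sU.
by have [//|] := maxU' N sN UN; apply.
Qed.

Lemma surj_of_notin_largest P (h : {linear P -> V}) x :
  ~ N (h x) -> surjective h.
Proof.
have [_ _ maxU] := maxN => nhx.
have [fU y|UN] := maxU _ (im_submodule h (full_submodule P)).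
  by have [z _ <-] := fU y; exists z.
by case: nhx; apply: UN; exists x.
Qed.

End Largest.

(** This is the largest submodule killed by [e]; a submodule not inside it contains some
    [e *: (a *: x) <> 0], hence [b]. *)
Lemma cyclic_largest_proper_sub T (b : T) (e : R) :
    (forall x, exists a, x = a *: b) -> b <> 0 -> e *: b = b ->
    (forall x, e *: x = 0 \/ exists a, a *: (e *: x) = b) ->
  largest_proper_sub (fun x : T => forall a, e *: (a *: x) = 0).
Proof.
move=> genb b0 eb ex; split.
- split=> [a|x y Nx Ny a|c x Nx a]; first by rewrite !scaler0.
    by rewrite !scalerDr Nx Ny addr0.
  by rewrite (scalerA a) Nx.
- by move/(_ b 1); rewrite scale1r eb.
move=> U [U0 UD UZ].
have [Ub|nUb] := EM (U b).
  by left=> x; have [a ->] := genb x; apply: UZ.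
right=> x Ux a; have [//|[c Ec]] := ex (a *: x).
by case: nUb; rewrite -Ec; exact: UZ (UZ _ _ (UZ _ _ Ux)).
Qed.

End Submodules.

(** * Quotient modules *)

Section QuotientModule.
Variables (R : nzRingType) (V : lmodType R) (U : V -> Prop).

(** Taking the proof as an argument lets the closure instance be attached to the predicate. *)
Definition sub_pred of submodule U : {pred V} := fun x => `[< U x >].

Variable sU : submodule U.

Fact sub_pred_zmod : zmod_closed (sub_pred sU).
Proof.
have [U0 UD UZ] := sU; split=> [|x y]; rewrite !unfold_in; first exact/asboolP.
move=> /asboolP Ux /asboolP Uy; apply/asboolP; apply: UD => //.
by rewrite -scaleN1r; apply: UZ.
Qed.
HB.instance Definition _ :=
  GRing.isZmodClosed.Build V (sub_pred sU) sub_pred_zmod.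

Definition quot_mod := Quotient.quot (sub_pred sU).
HB.instance Definition _ := GRing.Zmodule.on quot_mod.

Definition quot_pi : V -> quot_mod := \pi_(Quotient.quot (sub_pred sU)).

Lemma quot_pi_eq x y : quot_pi x = quot_pi y <-> U (x - y).
Proof.
have E := Quotient.idealrBE (sub_pred sU) x y.
rewrite unfold_in in E; split=> [/eqP|Uxy]; first by rewrite -E => /asboolP.
by apply/eqP; rewrite -E; apply/asboolP.
Qed.

Lemma quot_pi_repr x : quot_pi (generic_quotient.repr x) = x.
Proof. exact: reprK. Qed.

Lemma quot_pi_add : {morph quot_pi : x y / x + y}.
Proof. exact: raddfD. Qed.

Definition quot_scale (a : R) (x : quot_mod) : quot_mod :=
  quot_pi (a *: generic_quotient.repr x).

Lemma quot_pi_scale a x : quot_pi (a *: x) = quot_scale a (quot_pi x).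
Proof.
have [_ _ UZ] := sU; apply/quot_pi_eq; rewrite -scalerBr; apply: UZ.
by apply/quot_pi_eq; rewrite quot_pi_repr.
Qed.

Fact quot_scaleA a b x : quot_scale a (quot_scale b x) = quot_scale (a * b) x.
Proof. by rewrite -[x]quot_pi_repr -!quot_pi_scale scalerA. Qed.

Fact quot_scale1 : left_id 1 quot_scale.
Proof. by move=> x; rewrite /quot_scale scale1r quot_pi_repr. Qed.

Fact quot_scaleDr : right_distributive quot_scale +%R.
Proof.
move=> a x y; rewrite -[x]quot_pi_repr -[y]quot_pi_repr -quot_pi_add.
by rewrite -!quot_pi_scale scalerDr quot_pi_add.
Qed.

Fact quot_scaleDl x : {morph quot_scale^~ x : a b / a + b}.
Proof.
by move=> a b; rewrite -[x]quot_pi_repr -!quot_pi_scale scalerDl quot_pi_add.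
Qed.

HB.instance Definition _ := GRing.Zmodule_isLmodule.Build R quot_mod
  quot_scaleA quot_scale1 quot_scaleDr quot_scaleDl.

Fact quot_pi_linear : linear quot_pi.
Proof. by move=> a x y; rewrite quot_pi_add quot_pi_scale. Qed.

HB.instance Definition _ :=
  GRing.isSemilinear.Build R V quot_mod _ quot_pi
    (GRing.semilinear_linear quot_pi_linear).

Lemma quot_pi_surj : surjective quot_pi.
Proof. by move=> x; exists (generic_quotient.repr x); rewrite quot_pi_repr. Qed.

Lemma quot_pi_eq0 x : quot_pi x = 0 <-> U x.
Proof. by rewrite -(linear0 quot_pi) quot_pi_eq subr0. Qed.

End QuotientModule.

Lemma largest_proper_sub_simple (R : nzRingType) (V : lmodType R)
    (N : V -> Prop) (sN : submodule N) :
  largest_proper_sub N -> simple_module (quot_mod sN).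
Proof.
move=> [_ nN maxU]; split=> [|U sU].
  have /existsNP[x nx] := nN; exists (quot_pi sN x) => /quot_pi_eq0.
  exact: nx.
have [fU|UN] := maxU _ (preim_submodule (quot_pi sN) sU).
  by right=> x; rewrite -(quot_pi_repr x); apply: fU.
left=> x Ux; rewrite -(quot_pi_repr x); apply/quot_pi_eq0/UN.
by rewrite /= quot_pi_repr.
Qed.

(** * The projective module of an idempotent *)

Section IdempotentModule.
Variables (R : nzRingType) (f : R).

(** For [f] idempotent this is the left ideal [R f], that is, the right ideal [f A] when [R] is
    [A^c]. *)
Definition idem_pred : {pred R^o} := fun x => (x : R) * f == x.

Fact idem_pred_submod : submod_closed idem_pred.
Proof.
split=> [|a x y]; rewrite !unfold_in ?mul0r //.
by move=> /eqP xf /eqP yf; rewrite mulrDl -mulrA xf yf.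
Qed.
HB.instance Definition _ := GRing.isSubmodClosed.Build R R^o idem_pred
  idem_pred_submod.

Definition idem_mod := {x : R^o | x \in idem_pred}.
HB.instance Definition _ := SubChoice.on idem_mod.
HB.instance Definition _ := [SubChoice_isSubLmodule of idem_mod by <:].

Lemma idem_modP (x : idem_mod) : val x * f = val x.
Proof. by apply/eqP; have := valP x; rewrite unfold_in. Qed.

Section Eval.
Variables (V : lmodType R) (v : V).

Definition idem_eval (x : idem_mod) : V := (val x : R) *: v.

Fact idem_eval_linear : linear idem_eval.
Proof. by move=> a x y; rewrite /idem_eval linearP /= scalerDl scalerA. Qed.

HB.instance Definition _ := GRing.isSemilinear.Build R idem_mod V _ idem_eval
  (GRing.semilinear_linear idem_eval_linear).

End Eval.

Hypothesis ff : f * f = f.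

Fact idem_gen_proof : f \in idem_pred.
Proof. by rewrite unfold_in ff. Qed.

Definition idem_gen : idem_mod := Sub (f : R^o) idem_gen_proof.

Lemma idem_mod_gen (x : idem_mod) : x = (val x : R) *: idem_gen.
Proof. by apply: val_inj; rewrite linearZ /= -[in LHS]idem_modP. Qed.

(** A map out of [R f] is determined by the image of [f]; any preimage [y] of it gives the lift
    sending [x] to [x *: y]. *)
Lemma idem_mod_projective : projective idem_mod.
Proof.
move=> V1 V2 g h g_surj; have [y Ey] := g_surj (h idem_gen).
exists (idem_eval y) => x.
by rewrite /= /idem_eval linearZ /= Ey -linearZ /= -idem_mod_gen.
Qed.

End IdempotentModule.

(* [d] behaves like the rank of right multiplication by [x] on a finite
   dimensional algebra: a left multiple of maximal rank generates the same left
   ideal, and a right multiple of maximal rank has the same kernel. *)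
Definition rank_function (R : nzRingType) (d : R -> nat) : Prop :=
  (forall x y, (d y <= d (x * y)%R)%N -> exists z, y = z * (x * y)) /\
  (forall x y t, (d x <= d (x * y)%R)%N -> t * (x * y) = 0 -> t * x = 0).

(** * Projective covers from minimal rank *)

Section ProjectiveCover.
Variables (R : nzRingType) (d : R -> nat) (T : lmodType R).
Hypothesis rd : rank_function d.

Lemma min_stabilizer (b : T) : exists2 u : R, u *: b = b &
  forall v, v *: b = b -> (d u <= d v)%N.
Proof.
suff H n : forall v : R, v *: b = b -> (d v < n)%N ->
    exists2 u : R, u *: b = b & forall v, v *: b = b -> (d u <= d v)%N.
  exact: (H (d 1).+1 1 (scale1r b) (ltnSn _)).
elim: n => // n IHn u ub lt_u.
have [[v [vb lt_v]]|nex] := EM (exists v : R, v *: b = b /\ (d v < d u)%N).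
  by apply: (IHn v vb); apply: leq_trans lt_v _.
exists u => // v vb; rewrite leqNgt; apply/negP => lt_v; apply: nex.
by exists v.
Qed.

(* If [u] fixes [b] with [d u] minimal, then [u = r u^2] and [f = r u] is the
   unique left multiple of [u] with [f u = u]; hence it is idempotent. *)
Lemma min_idempotent (b : T) : exists f : R, [/\ f * f = f, f *: b = b &
  forall v, v * f = v -> v *: b = b -> exists z, f = z * v].
Proof.
have [rd1 rd2] := rd; have [u ub minu] := min_stabilizer b.
have du : (d u <= d (u * u))%N by apply: minu; rewrite -scalerA !ub.
have [r Er] := rd1 _ _ du.
exists (r * u); split.
- apply/eqP; rewrite -subr_eq0; apply/eqP.
  have -> : r * u * (r * u) - r * u = (r * u * r - r) * u.
    by rewrite mulrBl !mulrA.
  by apply: rd2 du _; rewrite mulrBl -!mulrA -2!Er subrr.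
- by rewrite -{1}ub scalerA -mulrA -Er ub.
(* Now [v = v * r * u] fixes [b], so minimality of [d u] recovers [u], and then [f = r * u], as a
   left multiple of [v]. *)
move=> v vf vb; rewrite mulrA in vf.
have [|z Ez] := rd1 (v * r) u; first by rewrite vf minu.
by exists (r * z); rewrite -mulrA -{1}vf -Ez.
Qed.

Lemma projective_cover (b : T) (N : T -> Prop) : largest_proper_sub N ->
    (forall x, exists a, x = a *: b) ->
  exists (P : lmodType R) (p : {linear P -> T}),
    [/\ projective P, surjective p & largest_proper_sub (fun x => N (p x))].
Proof.
move=> maxN genb; have [f [ff fb minf]] := min_idempotent b.
have [sN nN maxU] := maxN.
have surjp : surjective (idem_eval (f := f) b).
  move=> x; have [a ->] := genb x; exists (a *: idem_gen ff).
  by rewrite linearZ /= /idem_eval /= fb.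
exists (idem_mod f), (idem_eval b); split=> //.
  exact: idem_mod_projective.
split; first exact: preim_submodule.
  by move=> fN; apply: nN => x; have [y <-] := surjp x; apply: fN.
move=> U sU; have [fU|UN] := maxU _ (im_submodule (idem_eval b) sU); last first.
  by right=> x Ux; apply: UN; exists x.
(* Some [v] in [U] maps to [b]; by minimality [f] is a left multiple of it, so [U] contains the
   generator. *)
left=> x; have [v Uv vb] := fU b; have [z Ez] := minf _ (idem_modP v) vb.
have [_ _ UZ] := sU; rewrite (_ : x = (val x * z) *: v); first exact: UZ.
apply: val_inj; rewrite linearZ -[LHS]idem_modP.
exact: etrans (congr1 ( *%R (val x : R)) Ez) (mulrA _ _ _).
Qed.

End ProjectiveCover.

(** * The projective module [P_w] *)

Lemma is_proj_of_quotient (K : fieldType) (W : finCoxeterSystem) (w : W)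
    (N : transmod K w -> Prop) (P : lmodType (bh_algebra K W)^c) :
  largest_proper_sub N -> is_proj_of w P -> is_quotient P (transmod K w).
Proof.
move=> maxN [_ projP [S [[[y y0] _] [q q_surj kerq]] [p p_surj _]]].
(* [h] lifts [p] through [q], and [x] lies over [y <> 0], so [h x] is outside the radical. *)
have [h Eh] := projP _ _ q p q_surj; have [x Ex] := p_surj y.
exists h; apply: (surj_of_notin_largest maxN (x := x)).
by move/(largest_proper_sub_rad maxN)/kerq; rewrite Eh Ex.
Qed.

Lemma is_proj_of_exists (K : fieldType) (W : finCoxeterSystem) (w : W)
    (d : (bh_algebra K W)^c -> nat) (b : transmod K w)
    (N : transmod K w -> Prop) :
    rank_function d -> (forall x, exists a, x = a *: b) ->
    largest_proper_sub N ->
  exists P : lmodType (bh_algebra K W)^c, is_proj_of w P.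
Proof.
move=> rd genb maxN.
have [P [p [projP p_surj maxP]]] := projective_cover rd maxN genb.
have [sN _ _] := maxN; exists P; split=> //.
  exact: largest_proper_sub_indecomposable maxP.
exists (quot_mod sN).
  split; first exact: largest_proper_sub_simple.
  exists (quot_pi sN); first exact: quot_pi_surj.
  move=> x; apply: iff_trans (quot_pi_eq0 sN x) _.
  exact: iff_sym (largest_proper_sub_rad maxN x).
exists (quot_pi sN \o p).
  move=> z; have [y <-] := quot_pi_surj z; have [x <-] := p_surj y.
  by exists x.
move=> x; apply: iff_trans (quot_pi_eq0 sN (p x)) _.
exact: iff_sym (largest_proper_sub_rad maxP x).
Qed.

(** * Ranks in the regular representation *)

(** The product of [A^c] is reversed. If [L (y * x)] has the rank of [L y], their images agree; if
    it has the rank of [L x], the kernel of [L y] meets the image of [L x] trivially. *)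
Lemma rank_function_lmul (K : fieldType) (V : vectType K) (A : nzRingType)
    (phi : A -> V) (psi : V -> A) (L : A -> 'End(V)) :
    cancel psi phi -> cancel phi psi -> phi 0 = 0 ->
    (forall a b, L a (phi b) = phi (a * b)) ->
  rank_function (fun a : A^c => \dim (limg (L a))).
Proof.
move=> psiK phiK phi0 LE.
have LM a b : L (a * b) = (L a \o L b)%VF.
  by apply/lfunP => c; rewrite -[c]psiK comp_lfunE !LE mulrA.
pose d a := \dim (limg (L a)).
have d1 x y : (d y <= d (y * x)%R)%N -> exists z, y = y * x * z.
  rewrite /d LM limg_comp => le_d.
  have sub : (L y @: limg (L x) <= limg (L y))%VS by apply: limgS; apply: subvf.
  have: phi y \in limg (L y) by rewrite -{1}[y]mulr1 -LE memv_img ?memvf.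
  have /eqP <- : (L y @: limg (L x) == limg (L y))%VS by rewrite eqEdim sub.
  case/memv_imgP => _ /memv_imgP[c _ ->].
  rewrite -[c]psiK !LE mulrA => /(can_inj phiK) Ey.
  by exists (psi c).
have d2 x y t : (d x <= d (y * x)%R)%N -> y * x * t = 0 -> x * t = 0.
  rewrite /d LM limg_comp -mulrA => le_d yxt.
  have Ed := limg_ker_dim (L y) (limg (L x)).
  have cap0 : (limg (L x) :&: lker (L y) == 0)%VS.
    by rewrite -dimv_eq0; move: Ed le_d; lia.
  have : phi (x * t) \in (limg (L x) :&: lker (L y))%VS.
    by rewrite memv_cap memv_ker LE yxt phi0 eqxx andbT -LE memv_img ?memvf.
  by rewrite (eqP cap0) memv0 -phi0 => /eqP/(can_inj phiK).
by split=> [x y|x y t]; [apply: d1 | apply: d2].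
Qed.

Section RegularRank.
Variables (K : fieldType) (W : finCoxeterSystem).
Local Notation A := (bh_algebra K W).
Local Notation V := {ffun biHecke W -> K^o}.

Lemma mcoeff_sum (c : biHecke W -> K) f :
  (\sum_g << c g *g g >> : {malg K[biHecke W]})@_f = c f.
Proof.
rewrite raddf_sum (bigD1 f) /=; last by [].
rewrite [X in _ + X]big1 => [|g /negPf gf]; first by rewrite mcoeffUU addr0.
by rewrite mcoeffU gf.
Qed.

Definition coords (a : A) : V := [ffun f => a@_f].
(* Locked because unifying [of_coords c] with [of_coords c'] otherwise unfolds
   the monoid algebra and diverges. *)
Definition of_coords : V -> A := locked (fun c => \sum_f << c f *g f >>).

Lemma of_coordsK : cancel of_coords coords.
Proof.
by move=> c; apply/ffunP => f; rewrite ffunE /of_coords -lock mcoeff_sum.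
Qed.

Lemma coordsK : cancel coords of_coords.
Proof.
move=> a; apply/malgP => f.
by have /ffunP/(_ f) := of_coordsK (coords a); rewrite !ffunE.
Qed.

(** This makes left multiplication linear over [K]. *)
Lemma malgC_central (k : K) (a : A) : a * k%:MP = k%:MP * a.
Proof.
rewrite /malgC !malgM_def fgmulUg fgmulgU; apply: eq_bigr => f _.
by rewrite mulrC mulm1 mul1m.
Qed.

Lemma coordsD : {morph coords : a b / a + b}.
Proof. by move=> a b; apply/ffunP => f; rewrite !ffunE mcoeffD. Qed.

Lemma coords0 : coords 0 = 0.
Proof. by apply/ffunP => f; rewrite !ffunE mcoeff0. Qed.

Lemma coordsCM k (a : A) : coords (k%:MP * a) = k *: coords a.
Proof. by apply/ffunP => f; rewrite !ffunE mcoeffCM. Qed.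

Definition lmul_fun (a : A) (c : V) : V := coords (a * of_coords c).

Fact lmul_fun_linear a : linear (lmul_fun a).
Proof.
move=> k c1 c2; rewrite /lmul_fun -coordsCM -coordsD mulrA -malgC_central.
rewrite -mulrA -mulrDr; congr (coords (a * _)); apply: (can_inj coordsK).
by rewrite of_coordsK coordsD coordsCM !of_coordsK.
Qed.

HB.instance Definition _ a := GRing.isSemilinear.Build K V V _ (lmul_fun a)
  (GRing.semilinear_linear (lmul_fun_linear a)).

Definition lmul_coords (a : A) : 'End(V) := linfun (lmul_fun a).

Lemma lmul_coordsE (a b : A) : lmul_coords a (coords b) = coords (a * b).
Proof. by rewrite lfunE /= /lmul_fun coordsK. Qed.

Lemma rank_function_exists : exists d : A^c -> nat, rank_function d.
Proof.
exists (fun a => \dim (limg (lmul_coords a))).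
exact: rank_function_lmul of_coordsK coordsK coords0 lmul_coordsE.
Qed.

End RegularRank.

(** * The largest proper submodule of [T_w] *)

Section TranslationTop.
Variables (K : fieldType) (W : finCoxeterSystem) (w : W).
Local Notation T := (transmod K w).
Local Notation b := (transmod_basis K (bot w)).

Lemma transmod_scaleU (c : K) f (v : T) x :
  ((<< c *g f >> : (bh_algebra K W)^c) *: v) x =
  \sum_(u | trans_act f u == Some x) c * v u.
Proof.
rewrite ffunE (bigD1 f) /=; last by [].
rewrite [X in _ + X]big1 => [|g]; last first.
  rewrite eq_sym => /negPf fg; rewrite big1 // => u _.
  by rewrite mcoeffU fg mul0r.
by rewrite addr0; apply: eq_bigr => u _; rewrite mcoeffUU.
Qed.

Lemma transmod_scaleC (c : K) (v : T) x :
  ((<< c *g bh_one W >> : (bh_algebra K W)^c) *: v) x = c * v x.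
Proof.
rewrite transmod_scaleU (big_pred1 x) // => u.
by rewrite trans_act1 /= eqE.
Qed.

Lemma transmod_generated (v : T) : exists a : (bh_algebra K W)^c, v = a *: b.
Proof.
have [F FE] := choice (@trans_act_from_bot W w).
exists (\sum_u << v u *g F u >>); rewrite scaler_suml; apply/ffunP => y.
rewrite sum_ffunE (bigD1 y) //= big1 => [|u /negPf uy]; rewrite transmod_scaleU.
  rewrite addr0 (bigD1 (bot w)) ?FE //= ffunE eqxx mulr1 big1 ?addr0 // => u.
  by case/andP=> _ /negPf ub; rewrite ffunE ub mulr0.
rewrite big1 // => z /eqP Fz; rewrite ffunE.
case: eqP Fz => [->|]; last by rewrite mulr0.
by rewrite FE => -[Euy]; rewrite Euy eqxx in uy.
Qed.

Lemma transmod_largest_proper_sub : exists N : T -> Prop, largest_proper_sub N.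
Proof.
have [f fb fE] := trans_act_collapse w.
eexists; apply: (cyclic_largest_proper_sub (b := b) (e := << f >>)).
- exact: transmod_generated.
- by move/ffunP/(_ (bot w)); rewrite !ffunE eqxx => /eqP; rewrite oner_eq0.
- by rewrite transmod_basisE fb.
(* Since [f] sends every basis vector to [bot w] or 0, [y] is a multiple of [b]. *)
move=> x; set y := _ *: x; have yE u : u != bot w -> y u = 0.
  move=> ub; rewrite transmod_scaleU big1 // => v /eqP /fE Eu.
  by rewrite Eu eqxx in ub.
have [y0|y_neq0] := eqVneq (y (bot w)) 0; [left|right].
  apply/ffunP => u; rewrite [RHS]ffunE.
  by have [->|/yE] := eqVneq u (bot w).
exists << (y (bot w))^-1 *g bh_one W >>; apply/ffunP => u.
rewrite transmod_scaleC [RHS]ffunE.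
by case: (eqVneq u (bot w)) => [->|/yE ->]; [rewrite mulVf | rewrite mulr0].
Qed.

End TranslationTop.

(* The second conjunct makes explicit that P_w exists (in particular that
   T_w / rad T_w is simple), so that the third one is not vacuous. *)
Theorem corollary7p4 (W : finCoxeterSystem) (K : fieldType)
    (K0 : [pchar K] =i pred0) (w : cox_group W) :
  [/\ indecomposable (transmod K w),
      exists P : lmodType (bh_algebra K W)^c, is_proj_of w P &
      forall P : lmodType (bh_algebra K W)^c,
        is_proj_of w P -> is_quotient P (transmod K w)].
Proof.
have [N maxN] := transmod_largest_proper_sub K w.
have [d rd] := rank_function_exists K W.
split; first exact: largest_proper_sub_indecomposable maxN.
  exact: is_proj_of_exists rd (@transmod_generated K W w) maxN.
by move=> P; apply: is_proj_of_quotient maxN.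
Qed.
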